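(* For every integer $n\ge 2$, $$C\bigl(\mathcal C_n^{\mathrm{nd}}\bigr)\subseteq\mathcal C_n^{\mathrm{nd}}.$$ Consequently, for every $P_0\in\mathcal C_n^{\mathrm{nd}}$ the trajectory $P_{k+1}=C(P_k)$ is defined for all $k\ge 0$.
   Context: For nonconstant $x,y\in\mathbb R^n$, with means $\bar x,\bar y$, the Pearson correlation is $\operatorname{corr}(x,y)=\frac{\sum_k(x_k-\bar x)(y_k-\bar y)}{\sqrt{\sum_k(x_k-\bar x)^2\sum_k(y_k-\bar y)^2}}$. For a real $n\times n$ matrix $A$ all of whose rows $r_1,\dots,r_n$ are nonconstant, $C(A)$ is the $n\times n$ matrix with $[C(A)]_{ij}=\operatorname{corr}(r_i,r_j)$. $\mathcal C_n$ is the set of real symmetric positive semidefinite $n\times n$ matrices with unit diagonal, and $\mathcal C_n^{\mathrm{nd}}$ is the set of $P\in\mathcal C_n$ all of whose rows are nonconstant. *)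

(* Defs.v *)
From mathcomp Require Import all_boot all_order all_algebra.
From mathcomp Require Import classical_sets reals.

Set Implicit Arguments.
Unset Strict Implicit.
Unset Printing Implicit Defensive.

Import Order.TTheory GRing.Theory Num.Theory.
Local Open Scope classical_set_scope.
Local Open Scope ring_scope.

Section Correlation.
Variables (R : realType) (n : nat).
Implicit Types (x y : 'rV[R]_n) (A : 'M[R]_n).

Definition nonconstant x : Prop := ~ exists c : R, x = const_mx c.

Definition nonconstant_rows A : Prop := forall i, nonconstant (row i A).

Definition mean x : R := (\sum_k x 0 k) / n%:R.

(* Meaningful only for nonconstant x and y; otherwise the denominator is 0 and
   the convention 0^-1 = 0 makes the value 0. *)
Definition corr x y : R :=
  (\sum_k (x 0 k - mean x) * (y 0 k - mean y)) /
  Num.sqrt ((\sum_k (x 0 k - mean x) ^+ 2) * (\sum_k (y 0 k - mean y) ^+ 2)).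

(* The partial map C: its domain of definition is [nonconstant_rows]. *)
Definition corr_mx A : 'M[R]_n := \matrix_(i, j) corr (row i A) (row j A).

Definition psd A : Prop := forall x, 0 <= (x *m A *m x^T) 0 0.

Definition correlation_set : set 'M[R]_n :=
  [set P | [/\ P^T = P, psd P & forall i, P i i = 1]].

Definition nd_correlation_set : set 'M[R]_n :=
  [set P | correlation_set P /\ nonconstant_rows P].

(* An infinite trajectory of the partial map C: every term is required to lie
   in the domain of C, so that each step is really defined. *)
Definition corr_trajectory (P0 : 'M[R]_n) (P : nat -> 'M[R]_n) : Prop :=
  P 0%N = P0 /\
  forall k, nonconstant_rows (P k) /\ P k.+1 = corr_mx (P k).

End Correlation.

Arguments correlation_set : clear implicits.
Arguments nd_correlation_set : clear implicits.

(* Main.v *)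
Require Import Defs.
From mathcomp Require Import all_boot all_order all_algebra.
From mathcomp Require Import classical_sets reals.
From mathcomp Require Import ring lra.

Import Order.TTheory GRing.Theory Num.Theory.

Local Open Scope classical_set_scope.
Local Open Scope ring_scope.

(** The correlation of two vectors is the inner product of their
    standardizations (centre, then scale to unit length).  Hence [corr_mx A] is
    the Gram matrix [U *m U^T] of the standardized rows of [A]
    ([corr_mxE]), which makes it symmetric and positive semidefinite, with unit
    diagonal once every row of [A] is nonconstant ([corrxx]).

    It remains to see that no row of [corr_mx P] is constant when [P] is a
    correlation matrix with nonconstant rows.  A constant row has value 1, its
    diagonal entry.  Unit vectors with inner product 1 coincide
    ([standardize_eq]), so all the rows of [P] have one and the same
    standardization [u]: [P i j = m i + s i * u j] with [s i > 0].  Since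
    [P i i = 1], this says [P i j = 1 + s i * (u j - u i)], and the symmetry
    of [P] turns into [(s i + s j) * (u j - u i) = 0]; so [u] is constant, and
    so are the rows of [P], a contradiction ([collinear_rows_constant]).
    The set is therefore stable under the map, and the iterates of the map form
    the required trajectory. *)

Section Standardize.
Variables (R : realType) (n : nat).
Implicit Types (x y : 'rV[R]_n) (A P : 'M[R]_n).

Definition sq_dev x : R := \sum_k (x 0 k - mean x) ^+ 2.

Definition standardize x : 'rV[R]_n :=
  \row_k ((x 0 k - mean x) / Num.sqrt (sq_dev x)).

Lemma sq_dev_ge0 x : 0 <= sq_dev x.
Proof. by apply: sumr_ge0 => k _; rewrite sqr_ge0. Qed.

Lemma sum_sqr_eq0 (f : 'I_n -> R) :
  \sum_k f k ^+ 2 = 0 -> forall k, f k = 0.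
Proof.
move=> f0 k; apply/eqP; rewrite -sqrf_eq0; apply/eqP.
by apply: (psumr_eq0P _ f0) => // j _; apply: sqr_ge0.
Qed.

Lemma sq_dev_gt0 x : nonconstant x -> 0 < sq_dev x.
Proof.
move=> ncx; rewrite lt0r sq_dev_ge0 andbT; apply/negP => /eqP s0.
apply: ncx; exists (mean x); apply/rowP => k; rewrite mxE.
by apply/eqP; rewrite -subr_eq0; apply/eqP; apply: sum_sqr_eq0 s0 k.
Qed.

Lemma corrE x y : corr x y = \sum_k standardize x 0 k * standardize y 0 k.
Proof.
rewrite /corr -/(sq_dev x) -/(sq_dev y) sqrtrM ?sq_dev_ge0// invfM mulr_suml.
by apply: eq_bigr => k _; rewrite !mxE mulrACA.
Qed.

Lemma corrxx x : nonconstant x -> corr x x = 1.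
Proof.
move=> /sq_dev_gt0 s_gt0; rewrite /corr.
under eq_bigr do rewrite -expr2.
rewrite -/(sq_dev x) -expr2 sqrtr_sqr gtr0_norm// divff//.
exact: lt0r_neq0.
Qed.

(** Equality case of the Cauchy-Schwarz inequality: the squared distance of
    the two standardizations is [1 + 1 - 2 * corr x y]. *)
Lemma standardize_eq x y :
  nonconstant x -> nonconstant y -> corr x y = 1 ->
  standardize x = standardize y.
Proof.
move=> ncx ncy cxy.
have d0 : \sum_k (standardize x 0 k - standardize y 0 k) ^+ 2 = 0.
  transitivity (corr x x - corr x y *+ 2 + corr y y); last first.
    by rewrite !corrxx// cxy; ring.
  rewrite !corrE -sumrMnl -sumrB -big_split/=.
  by apply: eq_bigr => k _; ring.
apply/rowP => k.
by apply/eqP; rewrite -subr_eq0; apply/eqP; apply: sum_sqr_eq0 d0 k.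
Qed.

Lemma standardizeK x k : nonconstant x ->
  x 0 k = mean x + Num.sqrt (sq_dev x) * standardize x 0 k.
Proof.
move=> /sq_dev_gt0 s_gt0; rewrite mxE mulrC divfK ?subrKC//.
by rewrite lt0r_neq0// sqrtr_gt0.
Qed.

Definition standardized_rows A : 'M[R]_n :=
  \matrix_(i, j) standardize (row i A) 0 j.

Lemma corr_mxE A : corr_mx A = standardized_rows A *m (standardized_rows A)^T.
Proof.
apply/matrixP => i j; rewrite !mxE corrE.
by apply: eq_bigr => k _; rewrite !mxE.
Qed.

Lemma gram_psd A : psd (A *m A^T).
Proof.
move=> x.
rewrite mulmxA -mulmxA -trmx_mul mxE.
by apply: sumr_ge0 => k _; rewrite [X in _ * X]mxE -expr2 sqr_ge0.
Qed.

Lemma corr_mx_correlation A :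
  nonconstant_rows A -> correlation_set R n (corr_mx A).
Proof.
move=> ncA; split.
- by rewrite corr_mxE trmx_mul trmxK.
- by rewrite corr_mxE; apply: gram_psd.
- by move=> i; rewrite mxE corrxx.
Qed.

(** Comparing [P i j = 1 + s i * (u j - u i)] with
    [P j i = 1 + s j * (u i - u j)] forces [u j = u i] because the scales are
    positive. *)
Lemma collinear_rows_constant P (m s u : 'I_n -> R) :
  P^T = P -> (forall i, P i i = 1) -> (forall i, 0 < s i) ->
  (forall i j, P i j = m i + s i * u j) -> forall i j, P i j = 1.
Proof.
move=> symP P1 s_gt0 PE i j.
have Pij : P i j = P j i by rewrite -{1}symP mxE.
have := P1 i; have := P1 j; move: Pij; rewrite !PE => Pij Pjj Pii.
have : (s i + s j) * (u j - u i) = 0 by nra.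
move/eqP; rewrite mulf_eq0 gt_eqF ?addr_gt0//= subr_eq0 => /eqP ->.
exact: Pii.
Qed.

Lemma corr_mx_nonconstant P :
  nd_correlation_set R n P -> nonconstant_rows (corr_mx P).
Proof.
move=> [[symP _ P1] ncP] i [c ci].
have corr_c j : corr (row i P) (row j P) = c.
  by move/rowP/(_ j): ci; rewrite !mxE.
have corr1 j : corr (row i P) (row j P) = 1.
  by rewrite corr_c -(corr_c i) corrxx.
have PE j k : P j k = mean (row j P) +
    Num.sqrt (sq_dev (row j P)) * standardize (row i P) 0 k.
  by rewrite (standardize_eq _ (row j P))// -standardizeK// mxE.
apply: (ncP i); exists 1; apply/rowP => j; rewrite !mxE.
apply: (collinear_rows_constant P _ _ _ symP P1 _ PE) => k.
by rewrite sqrtr_gt0 sq_dev_gt0.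
Qed.

Lemma corr_mx_nd P :
  nd_correlation_set R n P -> nd_correlation_set R n (corr_mx P).
Proof.
move=> ndP; split; last exact: corr_mx_nonconstant.
by apply: corr_mx_correlation; case: ndP.
Qed.

End Standardize.

Theorem theorem1 (R : realType) (n : nat) (hn : (2 <= n)%N) :
  [set corr_mx P | P in nd_correlation_set R n] `<=` nd_correlation_set R n /\
  (forall P0 : 'M[R]_n, nd_correlation_set R n P0 ->
     exists P : nat -> 'M[R]_n, corr_trajectory P0 P).
Proof.
split=> [_ [P ndP <-]|P0 ndP0]; first exact: corr_mx_nd.
exists (fun k => iter k (@corr_mx R n) P0); split=> // k; split=> //.
suff [] : nd_correlation_set R n (iter k (@corr_mx R n) P0) by [].
by elim: k => //= k; apply: corr_mx_nd.
Qed.
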